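(* The midpoint algebra $\mathbb{I}=[-1,1]$ in the category $\mathbf{Loc}$ of locales, with $m(x,y)=\frac{x+y}{2}$, is iterative: for every locale $X$ and all locale maps $h\colon X\to\mathbb{I}$ and $t\colon X\to X$ there is a unique locale map $M\colon X\to\mathbb{I}$ such that $M=m\circ(\mathbb{I}\times M)\circ\langle h,t\rangle$, i.e. $M(x)=m(h(x),M(t(x)))$.
   Context: $\mathbb{I}$ is the locale of Dedekind reals in the closed interval $[-1,1]$: its points are the Dedekind sections $(L,U)$ with $1\notin L$ and $-1\notin U$. A midpoint algebra in a category with finite products is an object $A$ with a morphism $m\colon A\times A\to A$ satisfying $m(x,x)=x$, $m(x,y)=m(y,x)$ and $m(m(x,y),m(z,w))=m(m(x,z),m(y,w))$. *)

(* Defs.v *)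
From HB Require Import structures.
From mathcomp Require Import all_boot all_order all_algebra.
From mathcomp Require Import boolp classical_sets.
From mathcomp Require Import lra.

Set Implicit Arguments.
Unset Strict Implicit.
Unset Printing Implicit Defensive.

Import Order.TTheory GRing.Theory Num.Theory.

Local Open Scope classical_set_scope.
Local Open Scope order_scope.

Record cartesianCategory := CartesianCategory {
  object :> Type;
  hom : object -> object -> Type;
  idm : forall A, hom A A;
  mcomp : forall A B C, hom B C -> hom A B -> hom A C;
  mcompA : forall A B C D (f : hom C D) (g : hom B C) (h : hom A B),
    mcomp f (mcomp g h) = mcomp (mcomp f g) h;
  mcomp1m : forall A B (f : hom A B), mcomp (idm B) f = f;
  mcompm1 : forall A B (f : hom A B), mcomp f (idm A) = f;
  terminal : object;
  bang : forall A, hom A terminal;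
  bang_unique : forall A (f : hom A terminal), f = bang A;
  cprod : object -> object -> object;
  pi1 : forall A B, hom (cprod A B) A;
  pi2 : forall A B, hom (cprod A B) B;
  mpair : forall A B X, hom X A -> hom X B -> hom X (cprod A B);
  pi1_mpair : forall A B X (f : hom X A) (g : hom X B),
    mcomp (pi1 A B) (mpair f g) = f;
  pi2_mpair : forall A B X (f : hom X A) (g : hom X B),
    mcomp (pi2 A B) (mpair f g) = g;
  mpair_unique : forall A B X (k : hom X (cprod A B)),
    k = mpair (mcomp (pi1 A B) k) (mcomp (pi2 A B) k)
}.

Arguments hom {_} _ _.
Arguments idm {_} A.
Arguments mcomp {_ _ _ _} f g.
Arguments bang {_} A.
Arguments cprod {_} A B.
Arguments pi1 {_ A B}.
Arguments pi2 {_ A B}.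
Arguments mpair {_ _ _ _} f g.

Declare Scope cat_scope.
Delimit Scope cat_scope with cat.
Bind Scope cat_scope with hom.

Notation "A ~> B" := (hom A B) (at level 99, B at level 200) : type_scope.
Notation "f ∘ g" := (mcomp f g) (at level 40, left associativity) : cat_scope.
Notation "⟨ f , g ⟩" := (mpair f g) (at level 0, f, g at level 99) : cat_scope.

Definition prodmap (C : cartesianCategory) (A A' B B' : C)
    (f : A ~> A') (g : B ~> B') : cprod A B ~> cprod A' B' :=
  ⟨f ∘ pi1, g ∘ pi2⟩%cat.

Notation "f ⊗ g" := (prodmap f g) (at level 39, left associativity) : cat_scope.

(* The three equations are stated for the generic elements of [A], of
   [A * A] and of [(A * A) * (A * A)]. *)
Record midpointAlgebra (C : cartesianCategory) := MidpointAlgebra {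
  carrier :> C;
  mid : cprod carrier carrier ~> carrier;
  mid_idem : (mid ∘ ⟨idm carrier, idm carrier⟩ = idm carrier)%cat;
  mid_comm : (mid ∘ ⟨pi2, pi1⟩ = mid)%cat;
  mid_medial :
    let x : cprod (cprod carrier carrier) (cprod carrier carrier)
              ~> carrier := (pi1 ∘ pi1)%cat in
    let y := (pi2 ∘ pi1)%cat in
    let z := (pi1 ∘ pi2)%cat in
    let w := (pi2 ∘ pi2)%cat in
    (mid ∘ ⟨mid ∘ ⟨x, y⟩, mid ∘ ⟨z, w⟩⟩
     = mid ∘ ⟨mid ∘ ⟨x, z⟩, mid ∘ ⟨y, w⟩⟩)%cat
}.

Arguments mid {C} A : rename.

Definition iterative (C : cartesianCategory) (A : midpointAlgebra C) : Prop :=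
  forall (X : C) (h : X ~> A) (t : X ~> X),
    exists! M : X ~> A, (M = mid A ∘ (idm A ⊗ M) ∘ ⟨h, t⟩)%cat.

HB.mixin Record TMeetSemilattice_isFrame d T of Order.TMeetSemilattice d T := {
  Sup : set T -> T;
  le_Sup : forall (S : set T) x, S x -> x <= Sup S;
  Sup_le : forall (S : set T) y, (forall x, S x -> x <= y) -> Sup S <= y;
  meet_Sup : forall (x : T) (S : set T),
    Order.meet x (Sup S) = Sup [set Order.meet x y | y in S]
}.

#[short(type="frameType")]
HB.structure Definition Frame d :=
  {T of TMeetSemilattice_isFrame d T & Order.TMeetSemilattice d T}.

Arguments le_Sup {d s} [S x] : rename.
Arguments Sup_le {d s} [S y] : rename.

Record locale := Locale {
  locale_disp : Order.disp_t;
  opens : frameType locale_disp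
}.

Record locmap (X Y : locale) := Locmap {
  preim : opens Y -> opens X;
  preimT : preim \top = \top;
  preimI : forall u v, preim (Order.meet u v) = Order.meet (preim u) (preim v);
  preimS : forall S : set (opens Y), preim (Sup S) = Sup (preim @` S)
}.

Lemma locmap_ext (X Y : locale) (f g : locmap X Y) :
  (forall u, preim f u = preim g u) -> f = g.
Proof.
case: f g => [f f1 f2 f3] [g g1 g2 g3] /= /funext fg.
by move: f1 f2 f3; rewrite fg => *; congr Locmap; apply: Prop_irrelevance.
Qed.

Section LocmapId.
Context (X : locale).

Fact idS (S : set (opens X)) : id (Sup S) = Sup (id @` S).
Proof. by rewrite image_id. Qed.

Definition locmap_id : locmap X X := @Locmap X X id erefl (fun _ _ => erefl) idS.

End LocmapId.

Section LocmapComp.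
Context (X Y Z : locale) (f : locmap Y Z) (g : locmap X Y).

Let preim_comp (u : opens Z) : opens X := preim g (preim f u).

Fact compT : preim_comp \top = \top.
Proof. by rewrite /preim_comp !preimT. Qed.

Fact compI u v : preim_comp (Order.meet u v) = Order.meet (preim_comp u) (preim_comp v).
Proof. by rewrite /preim_comp !preimI. Qed.

Fact compS S : preim_comp (Sup S) = Sup (preim_comp @` S).
Proof. by rewrite /preim_comp !preimS image_comp. Qed.

Definition locmap_comp : locmap X Z := Locmap compT compI compS.

End LocmapComp.

Section FrameTheory.
Context (d : Order.disp_t) (F : frameType d).
Implicit Types (x y z : F) (S T : set F).

Lemma le_SupP S y : (Sup S <= y) <-> (forall x, S x -> x <= y).
Proof.
split=> [Sy x Sx|]; last exact: Sup_le.
exact: le_trans (le_Sup Sx) Sy.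
Qed.

Lemma Sup_mono S T : (forall x, S x -> exists2 y, T y & x <= y) ->
  Sup S <= Sup T.
Proof.
by move=> ST; apply: Sup_le => x /ST[y Ty xy]; exact: le_trans xy (le_Sup Ty).
Qed.

Lemma meet_Sup_le x S y :
  (forall z, S z -> Order.meet x z <= y) -> Order.meet x (Sup S) <= y.
Proof. by move=> H; rewrite meet_Sup; apply: Sup_le => _ [z /H ? <-]. Qed.

Lemma Sup_meet_le x S y :
  (forall z, S z -> Order.meet z x <= y) -> Order.meet (Sup S) x <= y.
Proof.
by move=> H; rewrite meetC; apply: meet_Sup_le => z /H; rewrite meetC.
Qed.

Lemma Sup1 x : Sup [set x] = x.
Proof.
apply: le_anti; rewrite le_Sup// andbT.
by apply: Sup_le => _ ->.
Qed.

End FrameTheory.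

Lemma preim_mono (X Y : locale) (f : locmap X Y) u v :
  u <= v -> preim f u <= preim f v.
Proof. by rewrite !leEmeet -preimI => /eqP ->. Qed.

Lemma preim_meets (X Y : locale) (f : locmap X Y) I (s : seq I) (F : I -> opens Y) :
  preim f (\meet_(i <- s) F i) = \meet_(i <- s) preim f (F i).
Proof.
by elim: s => [|i s IH]; rewrite ?(big_nil, big_cons) ?preimT// preimI IH.
Qed.

(* [axiom T s B] reads: the conjunction of the generators in [s] entails the
   disjunction over [b] in [B] of the conjunctions of the generators in [b]. *)
Record geometricTheory := GeometricTheory {
  generator : choiceType;
  axiom : seq generator -> set (seq generator) -> Prop
}.

Definition is_model (T : geometricTheory) d (F : frameType d)
    (f : generator T -> F) : Prop :=
  forall s B, axiom s B ->
    \meet_(g <- s) f g <= Sup [set \meet_(g <- b) f g | b in B].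

(* The frame presented by [T] consists of the ideals for the coverage that [T]
   induces on the free meet-semilattice over its generators; elements of the
   latter are represented by finite sequences, longer ones being smaller. *)
Definition is_ideal (T : geometricTheory) (U : set (seq (generator T))) : Prop :=
  (forall s s', {subset s <= s'} -> U s -> U s') /\
  (forall s B r, axiom s B -> (forall b, B b -> U (r ++ b)) -> U (r ++ s)).

Record ideal (T : geometricTheory) := Ideal {
  ideal_set :> seq (generator T) -> Prop;
  idealP : is_ideal ideal_set
}.

HB.instance Definition _ (T : geometricTheory) := gen_eqMixin (ideal T).
HB.instance Definition _ (T : geometricTheory) := gen_choiceMixin (ideal T).

Fact ideal_display : Order.disp_t. Proof. exact: Order.Disp tt tt. Qed.

Section IdealFrame.
Context (T : geometricTheory).
Implicit Types (U V W : ideal T) (S : set (ideal T)) (A : set (seq (generator T))).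

Lemma ideal_ext U V : ideal_set U = ideal_set V -> U = V.
Proof.
case: U V => [U pU] [V pV] /= UV; move: pU; rewrite UV => pU.
by congr Ideal; apply: Prop_irrelevance.
Qed.

Definition ideal_le U V := `[< ideal_set U `<=` ideal_set V >].

Lemma ideal_leP U V : reflect (ideal_set U `<=` ideal_set V) (ideal_le U V).
Proof. exact: asboolP. Qed.

Fact ideal_le_refl : reflexive ideal_le.
Proof. by move=> U; apply/ideal_leP. Qed.

Fact ideal_le_anti : antisymmetric ideal_le.
Proof.
move=> U V /andP[/ideal_leP UV /ideal_leP VU].
by apply: ideal_ext; apply/seteqP.
Qed.

Fact ideal_le_trans : transitive ideal_le.
Proof.
move=> V U W /ideal_leP UV /ideal_leP VW; apply/ideal_leP.
exact: subset_trans UV VW.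
Qed.

HB.instance Definition _ := Order.Le_isPOrder.Build ideal_display (ideal T)
  ideal_le_refl ideal_le_anti ideal_le_trans.

Lemma ideal_meet_subproof U V : is_ideal (ideal_set U `&` ideal_set V)%classic.
Proof.
have [U1 U2] := idealP U; have [V1 V2] := idealP V.
split=> [s s' ss' [Us Vs]|s B r ax H]; split.
- exact: U1 Us.
- exact: V1 Vs.
- by apply: U2 ax _ => b /H[].
- by apply: V2 ax _ => b /H[].
Qed.

Definition ideal_meet U V := Ideal (ideal_meet_subproof U V).

Fact ideal_lexI U V W : (U <= ideal_meet V W) = (U <= V) && (U <= W).
Proof.
apply/ideal_leP/andP => [UVW|[/ideal_leP UV /ideal_leP UW]].
- by split; apply/ideal_leP => s /UVW[].
- by move=> s Us; split; [exact: UV|exact: UW].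
Qed.

HB.instance Definition _ :=
  Order.POrder_isMeetSemilattice.Build ideal_display (ideal T) ideal_lexI.

Lemma ideal_top_subproof : is_ideal [set: seq (generator T)].
Proof. by []. Qed.

Definition ideal_top := Ideal ideal_top_subproof.

Fact ideal_lex1 U : U <= ideal_top.
Proof. exact/ideal_leP. Qed.

HB.instance Definition _ := Order.hasTop.Build ideal_display (ideal T) ideal_lex1.

Lemma ideal_gen_subproof A :
  is_ideal [set s | forall V, A `<=` ideal_set V -> V s].
Proof.
split=> [s s' ss' Us V AV|s B r ax H V AV].
- exact: (idealP V).1 ss' (Us _ AV).
- by apply: (idealP V).2 ax _ => b /H; exact.
Qed.

Definition ideal_gen A := Ideal (ideal_gen_subproof A).

Lemma sub_ideal_gen A : A `<=` ideal_set (ideal_gen A).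
Proof. by move=> s As V; exact. Qed.

Lemma ideal_gen_le A V : A `<=` ideal_set V -> ideal_gen A <= V.
Proof. by move=> AV; apply/ideal_leP => s; exact. Qed.

Definition ideal_Sup S := ideal_gen [set s | exists2 U : ideal T, S U & U s].

Fact ideal_le_Sup S U : S U -> U <= ideal_Sup S.
Proof. by move=> SU; apply/ideal_leP => s Us V; apply; exists U. Qed.

Fact ideal_Sup_le S V : (forall U, S U -> U <= V) -> ideal_Sup S <= V.
Proof. by move=> SV; apply: ideal_gen_le => s [U /SV/ideal_leP]; exact. Qed.

Fact ideal_meet_Sup U S :
  Order.meet U (ideal_Sup S) = ideal_Sup [set Order.meet U V | V in S].
Proof.
apply: le_anti; apply/andP; split; last first.
  apply: ideal_Sup_le => _ [V SV <-]; rewrite lexI leIl/=.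
  by apply: le_trans (leIr _ _) _; exact: ideal_le_Sup.
set W := ideal_Sup [set _ | _ in _].
have [U1 U2] := idealP U; have [W1 W2] := idealP W.
have impP : is_ideal [set s | forall s', {subset s <= s'} -> U s' -> W s'].
  split=> [s s' ss' H r sr|s B r ax H s' ss' Us'].
    by apply: H => g /ss'/sr.
  apply: (W1 (s' ++ s)).
    by move=> g; rewrite mem_cat => /orP[//|gs]; apply: ss'; rewrite mem_cat gs orbT.
  apply: W2 ax _ => b Bb; apply: (H b Bb).
    move=> g; rewrite !mem_cat => /orP[gr|->]; rewrite ?orbT//.
    by rewrite ss'// mem_cat gr.
  by apply: U1 Us' => g; rewrite mem_cat => ->.
apply/ideal_leP => s [Us /(_ (Ideal impP)) SUs].
suff /SUs : [set s | exists2 U : ideal T, S U & U s] `<=` ideal_set (Ideal impP).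
  by move=> H; exact: (H s).

move=> r [V SV Vr] s' rs' Us'.
have /ideal_leP : Order.meet U V <= W by apply: ideal_le_Sup; exists V.
apply; split=> //; exact: (idealP V).1 rs' Vr.
Qed.

HB.instance Definition _ := TMeetSemilattice_isFrame.Build ideal_display (ideal T)
  ideal_le_Sup ideal_Sup_le ideal_meet_Sup.

Definition ideal1 (g : generator T) : ideal T := ideal_gen [set s | g \in s].

Lemma meets_ideal1_le U s : U s -> \meet_(g <- s) ideal1 g <= U.
Proof.
move=> Us; apply/ideal_leP => t; have [U1 U2] := idealP U.
have step g r : ideal1 g t -> U (g :: r) -> U (t ++ r).
  move=> gt; suff impP : is_ideal [set t | forall r, U (g :: r) -> U (t ++ r)].
    move/(_ (Ideal impP)) : gt; apply=> t' /= gt' r' /U1; apply=> x.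
    by rewrite inE mem_cat => /predU1P[->|->]; rewrite ?gt' ?orbT.
  split=> [v v' vv' H r' /H /U1|v B v' ax H r' Ur'].
    by apply=> x; rewrite !mem_cat => /orP[/vv' ->//|->]; rewrite orbT.
  apply: (U1 ((v' ++ r') ++ v)).
    by move=> x; rewrite !mem_cat orbAC.
  apply: U2 ax _ => b /H /(_ _ Ur') /U1; apply=> x.
  by rewrite !mem_cat orbAC.
suff gen r : U (s ++ r) -> (\meet_(g <- s) ideal1 g) t -> U (t ++ r).
  by move=> /(gen [::]); rewrite !cats0; exact.
elim: s r {Us} => [|g s IH] r /=.
  by move=> Ur _; apply: U1 Ur => x; rewrite mem_cat orbC => ->.
rewrite big_cons => /step Ur [/Ur Uts /(IH (t ++ r)) H].
have /H : U (s ++ t ++ r).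
  by apply: U1 Uts => x; rewrite !mem_cat orbCA.
by apply: U1 => x; rewrite !mem_cat orbA orbb.
Qed.

Lemma mem_meets_ideal1 s : (\meet_(g <- s) ideal1 g) s.
Proof.
have sub s' : {subset s <= s'} -> (\meet_(g <- s) ideal1 g) s'.
  elim: s => [|g s IH] ss'; rewrite ?big_nil// big_cons; split.
    by apply: sub_ideal_gen; apply: ss'; rewrite mem_head.
  by apply: IH => x xs; apply: ss'; rewrite inE xs orbT.
exact: sub.
Qed.

Lemma ideal1_model : is_model ideal1.
Proof.
move=> s B ax; apply: meets_ideal1_le; rewrite -[s]cat0s.
apply: (idealP _).2 ax _ => b Bb.
have /ideal_leP : \meet_(g <- b) ideal1 g <=
    Sup [set \meet_(g <- b0) ideal1 g | b0 in B] by apply: le_Sup; exists b.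
by apply; exact: mem_meets_ideal1.
Qed.

Lemma ideal_decomp U :
  U = Sup [set \meet_(g <- s) ideal1 g | s in ideal_set U].
Proof.
apply: le_anti; apply/andP; split.
  apply/ideal_leP => s Us.
  have /ideal_leP : \meet_(g <- s) ideal1 g <=
    Sup [set \meet_(g <- s) ideal1 g | s in ideal_set U].
    by apply: le_Sup; exists s.
  by apply; exact: mem_meets_ideal1.
by apply: Sup_le => _ [s Us <-]; exact: meets_ideal1_le.
Qed.

End IdealFrame.

Definition models (T : geometricTheory) : locale := Locale (ideal T).

Section Classify.
Context (T : geometricTheory) (X : locale) (f : generator T -> opens X).
Hypothesis fP : is_model f.

Definition classify_preim (U : opens (models T)) : opens X :=
  Sup [set \meet_(g <- s) f g | s in ideal_set U].

Lemma ideal_below z : is_ideal [set s | \meet_(g <- s) f g <= z].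
Proof.
split=> [s s1 ss1|s B r ax H]; rewrite /=.
  move=> sz; apply: le_trans sz; apply/meetsP_seq => g gs _.
  by apply: meets_inf_seq => //; exact: ss1.
rewrite big_cat/=; apply: le_trans (leI2 (lexx _) (fP ax)) _.
by apply: meet_Sup_le => _ [b /H Hb <-]; move: Hb; rewrite /= big_cat.
Qed.

Lemma classify_gen (A : set (seq (generator T))) :
  classify_preim (ideal_gen A) = Sup [set \meet_(g <- s) f g | s in A].
Proof.
apply: le_anti; apply/andP; split.
  apply: Sup_le => _ [s As <-].
  apply: (As (Ideal (ideal_below _))) => s' As' /=.
  by apply: le_Sup; exists s'.
apply: Sup_le => _ [s As <-]; apply: le_Sup; exists s => //.
exact: sub_ideal_gen.
Qed.

Fact classifyT : classify_preim \top = \top.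
Proof.
apply: le_anti; rewrite lex1/=; apply: le_Sup; exists [::] => //.
by rewrite big_nil.
Qed.

Fact classifyI (U V : opens (models T)) :
  classify_preim (Order.meet U V) =
  Order.meet (classify_preim U) (classify_preim V).
Proof.
apply: le_anti; apply/andP; split.
  by rewrite lexI; apply/andP; split; apply: Sup_mono => _ [s [Us Vs] <-];
    exists (\meet_(g <- s) f g) => //; exists s.
apply: Sup_meet_le => _ [s Us <-]; apply: meet_Sup_le => _ [s' Vs' <-].
apply: le_Sup; exists (s ++ s'); last by rewrite big_cat.
split; [apply: (idealP U).1 Us|apply: (idealP V).1 Vs'] => x;
  by rewrite mem_cat => ->; rewrite ?orbT.
Qed.

Fact classifyS (S : set (opens (models T))) :
  classify_preim (Sup S) = Sup (classify_preim @` S).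
Proof.
rewrite [LHS]classify_gen; apply: le_anti; apply/andP; split.
  apply: Sup_le => _ [s [U SU Us] <-].
  apply: (@le_trans _ _ (classify_preim U)); apply: le_Sup; first by exists s.
  by exists U.
apply: Sup_le => _ [U SU <-]; apply: Sup_mono => _ [s Us <-].
by exists (\meet_(g <- s) f g) => //; exists s => //; exists U.
Qed.

Definition classify : locmap X (models T) :=
  Locmap classifyT classifyI classifyS.

Lemma classifyE g : preim classify (ideal1 g) = f g.
Proof.
rewrite [LHS]classify_gen; apply: le_anti; apply/andP; split.
  by apply: Sup_le => _ [s gs <-]; apply: meets_inf_seq.
apply: le_Sup; exists [:: g]; last by rewrite big_seq1.
by rewrite /= mem_head.
Qed.

End Classify.

Lemma models_ext (T : geometricTheory) (X : locale) (f g : locmap X (models T)) :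
  (forall x, preim f (ideal1 x) = preim g (ideal1 x)) -> f = g.
Proof.
move=> fg; apply: locmap_ext => U; rewrite [U]ideal_decomp !preimS.
congr Sup; rewrite !image_comp; apply: eq_imagel => s _ /=.
by rewrite !preim_meets; apply: eq_bigr.
Qed.

Lemma locmap_model (T : geometricTheory) (X : locale) (f : locmap X (models T)) :
  is_model (fun x => preim f (ideal1 x)).
Proof.
move=> s B /ideal1_model /(preim_mono f).
rewrite preim_meets preimS image_comp; congr (_ <= Sup _).
by apply: eq_imagel => b _; rewrite /= preim_meets.
Qed.

Inductive no_axiom : seq void -> set (seq void) -> Prop := .

Definition loc1 : locale := models (GeometricTheory no_axiom).

Lemma loc1_model (X : locale) :
  @is_model (GeometricTheory no_axiom) _ (opens X) (of_void (opens X)).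
Proof. by move=> s B []. Qed.

Definition loc1_map (X : locale) : locmap X loc1 := classify (loc1_model X).

(* The frame of the product is presented by the opens of both factors, subject
   to the relations making each of the two inclusions a frame homomorphism. *)
Inductive prod_axiom (X Y : locale) :
    seq (opens X + opens Y) -> set (seq (opens X + opens Y)) -> Prop :=
  | prod_topl : prod_axiom [::] [set [:: inl \top]]
  | prod_meetl u v :
      prod_axiom [:: inl u; inl v] [set [:: inl (Order.meet u v)]]
  | prod_lel u v of u <= v : prod_axiom [:: inl u] [set [:: inl v]]
  | prod_Supl S : prod_axiom [:: inl (Sup S)] [set [:: inl u] | u in S]
  | prod_topr : prod_axiom [::] [set [:: inr \top]]
  | prod_meetr u v :
      prod_axiom [:: inr u; inr v] [set [:: inr (Order.meet u v)]]
  | prod_ler u v of u <= v : prod_axiom [:: inr u] [set [:: inr v]]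
  | prod_Supr S : prod_axiom [:: inr (Sup S)] [set [:: inr u] | u in S].

Definition prod_theory (X Y : locale) := GeometricTheory (@prod_axiom X Y).

Definition locprod (X Y : locale) : locale := models (prod_theory X Y).

Section LocaleProduct.
Context (X Y : locale).

Let gl (u : opens X) : opens (locprod X Y) :=
  @ideal1 (prod_theory X Y) (inl u).
Let gr (u : opens Y) : opens (locprod X Y) :=
  @ideal1 (prod_theory X Y) (inr u).

Let ax := @ideal1_model (prod_theory X Y).

Fact fstT : gl \top = \top.
Proof.
apply: le_anti; rewrite lex1/=; have := ax (@prod_topl X Y).
by rewrite big_nil image_set1 big_seq1 Sup1.
Qed.

Fact fst_mono u v : u <= v -> gl u <= gl v.
Proof.
by move=> /(@prod_lel X Y)/ax; rewrite big_seq1 image_set1 big_seq1 Sup1.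
Qed.

Fact fstI u v : gl (Order.meet u v) = Order.meet (gl u) (gl v).
Proof.
apply: le_anti; rewrite lexI !fst_mono ?leIl ?leIr//=.
have := ax (@prod_meetl X Y u v).
by rewrite !big_cons big_nil meetx1 image_set1 big_seq1 Sup1.
Qed.

Fact fstS S : gl (Sup S) = Sup (gl @` S).
Proof.
apply: le_anti; apply/andP; split; last first.
  by apply: Sup_le => _ [u Su <-]; apply: fst_mono; exact: le_Sup.
have := ax (@prod_Supl X Y S).
rewrite big_seq1 image_comp; congr (_ <= Sup _).
by apply: eq_imagel => u _; rewrite /= big_seq1.
Qed.

Definition locfst : locmap (locprod X Y) X := Locmap fstT fstI fstS.

Fact sndT : gr \top = \top.
Proof.
apply: le_anti; rewrite lex1/=; have := ax (@prod_topr X Y).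
by rewrite big_nil image_set1 big_seq1 Sup1.
Qed.

Fact snd_mono u v : u <= v -> gr u <= gr v.
Proof.
by move=> /(@prod_ler X Y)/ax; rewrite big_seq1 image_set1 big_seq1 Sup1.
Qed.

Fact sndI u v : gr (Order.meet u v) = Order.meet (gr u) (gr v).
Proof.
apply: le_anti; rewrite lexI !snd_mono ?leIl ?leIr//=.
have := ax (@prod_meetr X Y u v).
by rewrite !big_cons big_nil meetx1 image_set1 big_seq1 Sup1.
Qed.

Fact sndS S : gr (Sup S) = Sup (gr @` S).
Proof.
apply: le_anti; apply/andP; split; last first.
  by apply: Sup_le => _ [u Su <-]; apply: snd_mono; exact: le_Sup.
have := ax (@prod_Supr X Y S).
rewrite big_seq1 image_comp; congr (_ <= Sup _).
by apply: eq_imagel => u _; rewrite /= big_seq1.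
Qed.

Definition locsnd : locmap (locprod X Y) Y := Locmap sndT sndI sndS.

Context (Z : locale) (f : locmap Z X) (g : locmap Z Y).

Definition locpair_fun (w : opens X + opens Y) : opens Z :=
  match w with inl u => preim f u | inr v => preim g v end.

Lemma locpair_model : @is_model (prod_theory X Y) _ _ locpair_fun.
Proof.
move=> s B []; rewrite ?image_set1 ?big_cons ?big_nil ?meetx1 ?Sup1//=.
- by rewrite preimT.
- by move=> u v; rewrite image_set1 Sup1 !big_cons !big_nil !meetx1/= preimI.
- by move=> u v uv; rewrite !big_seq1 image_set1 big_seq1 Sup1; exact: preim_mono.
- move=> S; rewrite big_seq1/= preimS image_comp.
  by apply: Sup_mono => _ [u Su <-]; exists (preim f u) => //; exists u => //=;
    rewrite big_seq1.
- by rewrite preimT.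
- by move=> u v; rewrite image_set1 Sup1 !big_cons !big_nil !meetx1/= preimI.
- by move=> u v uv; rewrite !big_seq1 image_set1 big_seq1 Sup1; exact: preim_mono.
- move=> S; rewrite big_seq1/= preimS image_comp.
  by apply: Sup_mono => _ [u Su <-]; exists (preim g u) => //; exists u => //=;
    rewrite big_seq1.
Qed.

Definition locpair : locmap Z (locprod X Y) := classify locpair_model.

Lemma locfst_pair : locmap_comp locfst locpair = f.
Proof. by apply: locmap_ext => u /=; rewrite [LHS](classifyE locpair_model). Qed.

Lemma locsnd_pair : locmap_comp locsnd locpair = g.
Proof. by apply: locmap_ext => u /=; rewrite [LHS](classifyE locpair_model). Qed.

End LocaleProduct.

Lemma locpair_unique (X Y Z : locale) (k : locmap Z (locprod X Y)) :
  k = locpair (locmap_comp (locfst X Y) k) (locmap_comp (locsnd X Y) k).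
Proof. by apply: models_ext => -[u|v]; rewrite classifyE. Qed.

Lemma loc1_unique (X : locale) (f : locmap X loc1) : f = loc1_map X.
Proof. by apply: models_ext => -[]. Qed.

Lemma locmap_compA (X Y Z W : locale) (f : locmap Z W) (g : locmap Y Z)
    (h : locmap X Y) :
  locmap_comp f (locmap_comp g h) = locmap_comp (locmap_comp f g) h.
Proof. exact: locmap_ext. Qed.

Lemma locmap_comp1m (X Y : locale) (f : locmap X Y) :
  locmap_comp (locmap_id Y) f = f.
Proof. exact: locmap_ext. Qed.

Lemma locmap_compm1 (X Y : locale) (f : locmap X Y) :
  locmap_comp f (locmap_id X) = f.
Proof. exact: locmap_ext. Qed.

Definition Loc : cartesianCategory := CartesianCategory
  locmap_compA locmap_comp1m locmap_compm1 loc1_unique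
  locfst_pair locsnd_pair locpair_unique.

(* The theory of Dedekind sections [(L, U)] of the rationals with [1] not in
   [L] and [-1] not in [U]: the generator [inl q] stands for the proposition
   [q \in L], that is [q < x], and [inr q] for [q \in U], that is [x < q]. *)
Inductive interval_axiom : seq (rat + rat) -> set (seq (rat + rat)) -> Prop :=
  | L_inhabited : interval_axiom [::] [set [:: inl q] | q in [set: rat]]
  | U_inhabited : interval_axiom [::] [set [:: inr q] | q in [set: rat]]
  | L_down (q r : rat) of q < r : interval_axiom [:: inl r] [set [:: inl q]]
  | U_up (q r : rat) of q < r : interval_axiom [:: inr q] [set [:: inr r]]
  | L_rounded q :
      interval_axiom [:: inl q] [set [:: inl r] | r in [set r : rat | q < r]]
  | U_rounded q :
      interval_axiom [:: inr q] [set [:: inr r] | r in [set r : rat | r < q]]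
  | LU_disjoint q : interval_axiom [:: inl q; inr q] set0
  | LU_located (q r : rat) of q < r :
      interval_axiom [::] [set [:: inl q]; [:: inr r]]
  | L_bound : interval_axiom [:: inl 1%R] set0
  | U_bound : interval_axiom [:: inr (-1)%R] set0.

Definition interval_theory : geometricTheory := GeometricTheory interval_axiom.

Definition interval : locale := models interval_theory.

Section DedekindSection.
Context (d : Order.disp_t) (F : frameType d) (f : rat + rat -> F).

Record is_section : Prop := IsSection {
  sec_L_inhabited : \top <= Sup [set f (inl q) | q in [set: rat]];
  sec_U_inhabited : \top <= Sup [set f (inr q) | q in [set: rat]];
  sec_L_down : forall q r, q < r -> f (inl r) <= f (inl q);
  sec_U_up : forall q r, q < r -> f (inr q) <= f (inr r);
  sec_L_rounded : forall q,
    f (inl q) <= Sup [set f (inl r) | r in [set r : rat | q < r]];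
  sec_U_rounded : forall q,
    f (inr q) <= Sup [set f (inr r) | r in [set r : rat | r < q]];
  sec_disjoint : forall q, Order.meet (f (inl q)) (f (inr q)) <= Sup set0;
  sec_located : forall q r, q < r -> \top <= Sup [set f (inl q); f (inr r)];
  sec_L_bound : f (inl 1%R) <= Sup set0;
  sec_U_bound : f (inr (-1)%R) <= Sup set0
}.

Let E (w : rat -> rat + rat) (A : set rat) :
  [set \meet_(g <- b) f g | b in [set [:: w q] | q in A]] =
  [set f (w q) | q in A].
Proof. by rewrite image_comp; apply: eq_imagel => q _ /=; rewrite big_seq1. Qed.

Let E2 q r : [set \meet_(g <- b) f g | b in [set [:: inl q]; [:: inr r]]] =
  [set f (inl q); f (inr r)].
Proof. by rewrite image_setU !image_set1 !big_seq1. Qed.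

Lemma section_model : is_section -> @is_model interval_theory _ _ f.
Proof.
case=> L1 U1 L2 U2 L3 U3 D Lo B1 B2 s B [].
- by rewrite big_nil E.
- by rewrite big_nil E.
- by move=> q r /L2; rewrite big_seq1 image_set1 Sup1 big_seq1.
- by move=> q r /U2; rewrite big_seq1 image_set1 Sup1 big_seq1.
- by move=> q; rewrite big_seq1 E; exact: L3.
- by move=> q; rewrite big_seq1 E; exact: U3.
- by move=> q; rewrite big_cons big_seq1 image_set0; exact: D.
- by move=> q r /Lo; rewrite big_nil E2.
- by rewrite big_seq1 image_set0.
- by rewrite big_seq1 image_set0.
Qed.

Lemma model_section : @is_model interval_theory _ _ f -> is_section.
Proof.
move=> H; split.
- by have := H _ _ L_inhabited; rewrite big_nil E.
- by have := H _ _ U_inhabited; rewrite big_nil E.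
- by move=> q r /L_down/H; rewrite big_seq1 image_set1 Sup1 big_seq1.
- by move=> q r /U_up/H; rewrite big_seq1 image_set1 Sup1 big_seq1.
- by move=> q; have := H _ _ (L_rounded q); rewrite big_seq1 E.
- by move=> q; have := H _ _ (U_rounded q); rewrite big_seq1 E.
- by move=> q; have := H _ _ (LU_disjoint q); rewrite big_cons big_seq1 image_set0.
- by move=> q r /LU_located/H; rewrite big_nil E2.
- by have := H _ _ L_bound; rewrite big_seq1 image_set0.
- by have := H _ _ U_bound; rewrite big_seq1 image_set0.
Qed.

End DedekindSection.

Section SectionTheory.
Context (d : Order.disp_t) (F : frameType d) (x : rat + rat -> F).
Hypothesis xP : is_section x.
Local Open Scope ring_scope.

Lemma sec_L_le (q r : rat) : q <= r -> (x (inl r) <= x (inl q))%O.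
Proof. by rewrite le_eqVlt => /predU1P[->//|]; exact: sec_L_down. Qed.

Lemma sec_U_le (q r : rat) : q <= r -> (x (inr q) <= x (inr r))%O.
Proof. by rewrite le_eqVlt => /predU1P[->//|]; exact: sec_U_up. Qed.

Lemma sec_disjoint_le (q r : rat) (u : F) :
  q <= r -> (Order.meet (x (inl r)) (x (inr q)) <= u)%O.
Proof.
move=> qr; apply: (@le_trans _ _ (Sup set0)); last exact: Sup_le.
by apply: le_trans (sec_disjoint xP r); apply: leI2 => //; exact: sec_U_le.
Qed.

Lemma sec_L_bound_le (q : rat) (u : F) : 1 <= q -> (x (inl q) <= u)%O.
Proof.
move=> q1; apply: (@le_trans _ _ (Sup set0)); last exact: Sup_le.
exact: le_trans (sec_L_le q1) (sec_L_bound xP).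
Qed.

Lemma sec_U_bound_le (q : rat) (u : F) : q <= -1 -> (x (inr q) <= u)%O.
Proof.
move=> q1; apply: (@le_trans _ _ (Sup set0)); last exact: Sup_le.
exact: le_trans (sec_U_le q1) (sec_U_bound xP).
Qed.

Lemma sec_located_le (q r : rat) (w u : F) : q < r ->
  (Order.meet w (x (inl q)) <= u)%O -> (Order.meet w (x (inr r)) <= u)%O ->
  (w <= u)%O.
Proof.
move=> qr wq wr; rewrite -[w]meetx1.
apply: le_trans (leI2 (lexx _) (sec_located xP qr)) _.
by apply: meet_Sup_le => _ [|] ->.
Qed.

Lemma sec_approx (e : rat) (w u : F) : 0 < e ->
  (forall a, Order.meet w (Order.meet (x (inl a)) (x (inr (a + e)))) <= u)%O ->
  (w <= u)%O.
Proof.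
move=> e0 H.
have [n en] : exists n : nat, 2 < (e / 2) * n%:R.
  exists (Num.bound (2 / (e / 2))).
  have e2 : 0 < e / 2 by lra.
  rewrite mulrC -ltr_pdivrMr//; apply: archi_boundP.
  by apply: divr_ge0; lra.
suff K k (a : rat) : 1 <= a + (e / 2) * k%:R -> (Order.meet w (x (inl a)) <= u)%O.
  apply: (@sec_located_le (-1 - e / 2) (-1)); first by lra.
    by apply: (K n.+1); rewrite -(natr1 n) mulrDr mulr1; lra.
  by apply: le_trans (leIr _ _) _; apply: sec_U_bound_le.
elim: k a => [|k IH] a ak.
  by apply: le_trans (leIr _ _) _; apply: sec_L_bound_le; lra.
apply: (@sec_located_le (a + e / 2) (a + e)); first by lra.
  rewrite -meetA; apply: (@le_trans _ _ (Order.meet w (x (inl (a + e / 2))))).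
    by rewrite leI2// leIr.
  by apply: IH; move: ak; rewrite -(natr1 k) mulrDr mulr1; lra.
by rewrite -meetA; exact: H.
Qed.

End SectionTheory.

(* [(x + y) / 2]: a rational lies below (above) it if and only if it is the
   mean of a rational below (above) [x] and a rational below (above) [y]. *)
Definition mean_fun d (F : frameType d) (x y : rat + rat -> F)
    (w : rat + rat) : F :=
  match w with
  | inl q => Sup [set Order.meet (x (inl ab.1)) (y (inl ab.2)) |
                   ab in [set ab : rat * rat | ((ab.1 + ab.2) / 2 = q)%R]]
  | inr q => Sup [set Order.meet (x (inr ab.1)) (y (inr ab.2)) |
                   ab in [set ab : rat * rat | ((ab.1 + ab.2) / 2 = q)%R]]
  end.

Section Mean.
Context (d : Order.disp_t) (F : frameType d) (x y : rat + rat -> F).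
Local Open Scope ring_scope.

Lemma le_mean_L (a b q : rat) : (a + b) / 2 = q ->
  (Order.meet (x (inl a)) (y (inl b)) <= mean_fun x y (inl q))%O.
Proof. by move=> abq; apply: le_Sup; exists (a, b). Qed.

Lemma le_mean_U (a b q : rat) : (a + b) / 2 = q ->
  (Order.meet (x (inr a)) (y (inr b)) <= mean_fun x y (inr q))%O.
Proof. by move=> abq; apply: le_Sup; exists (a, b). Qed.

Lemma mean_L_le (q : rat) (u : F) :
  (forall a b, (a + b) / 2 = q -> Order.meet (x (inl a)) (y (inl b)) <= u)%O ->
  (mean_fun x y (inl q) <= u)%O.
Proof. by move=> H; apply: Sup_le => _ [[a b] /= ab <-]; exact: H. Qed.

Lemma mean_U_le (q : rat) (u : F) :
  (forall a b, (a + b) / 2 = q -> Order.meet (x (inr a)) (y (inr b)) <= u)%O ->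
  (mean_fun x y (inr q) <= u)%O.
Proof. by move=> H; apply: Sup_le => _ [[a b] /= ab <-]; exact: H. Qed.

Hypotheses (xP : is_section x) (yP : is_section y).

Lemma mean_section : is_section (mean_fun x y).
Proof.
split.
- rewrite -[leLHS]meetxx.
  apply: le_trans (leI2 (sec_L_inhabited xP) (sec_L_inhabited yP)) _.
  apply: Sup_meet_le => _ [a _ <-]; apply: meet_Sup_le => _ [b _ <-].
  apply: le_trans (le_mean_L erefl) _; apply: le_Sup.
  by exists ((a + b) / 2).
- rewrite -[leLHS]meetxx.
  apply: le_trans (leI2 (sec_U_inhabited xP) (sec_U_inhabited yP)) _.
  apply: Sup_meet_le => _ [a _ <-]; apply: meet_Sup_le => _ [b _ <-].
  apply: le_trans (le_mean_U erefl) _; apply: le_Sup.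
  by exists ((a + b) / 2).
- move=> q r qr; apply: mean_L_le => a b abr.
  apply: le_trans (@le_mean_L (a - (r - q) * 2) b q _); last by lra.
  by apply: leI2 => //; apply: sec_L_le => //; lra.
- move=> q r qr; apply: mean_U_le => a b abq.
  apply: le_trans (@le_mean_U (a + (r - q) * 2) b r _); last by lra.
  by apply: leI2 => //; apply: sec_U_le => //; lra.
- move=> q; apply: mean_L_le => a b abq.
  apply: le_trans (leI2 (sec_L_rounded xP a) (lexx _)) _.
  apply: Sup_meet_le => _ [a' aa' <-].
  apply: le_trans (le_mean_L erefl) _; apply: le_Sup.
  by exists ((a' + b) / 2) => //=; move: aa' => /=; lra.
- move=> q; apply: mean_U_le => a b abq.
  apply: le_trans (leI2 (sec_U_rounded xP a) (lexx _)) _.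
  apply: Sup_meet_le => _ [a' aa' <-].
  apply: le_trans (le_mean_U erefl) _; apply: le_Sup.
  by exists ((a' + b) / 2) => //=; move: aa' => /=; lra.
- move=> q; apply: Sup_meet_le => _ [[a b] /= abq <-].
  apply: meet_Sup_le => _ [[a' b'] /= abq' <-].
  rewrite meetACA; have [aa'|aa'] := leP a' a.
    by apply: le_trans (leIl _ _) _; exact: sec_disjoint_le.
  by apply: le_trans (leIr _ _) _; apply: sec_disjoint_le => //; lra.
- move=> q r qr; have e0 : 0 < r - q by lra.
  apply: (sec_approx xP e0) => a; apply: (sec_approx yP e0) => b.
  rewrite meet1x meetACA; have [abq|abq] := leP q ((a + b) / 2).
    apply: le_trans (leIl _ _) _.
    apply: (@le_trans _ _ (mean_fun x y (inl q))); last by apply: le_Sup; left.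
    apply: le_trans (@le_mean_L (q * 2 - b) b q _); last by lra.
    by apply: leI2 => //; apply: sec_L_le => //; lra.
  apply: le_trans (leIr _ _) _.
  apply: (@le_trans _ _ (mean_fun x y (inr r))); last by apply: le_Sup; right.
  apply: le_trans (@le_mean_U (r * 2 - (b + (r - q))) (b + (r - q)) r _); last by lra.
  by apply: leI2 => //; apply: sec_U_le => //; lra.
- apply: mean_L_le => a b ab; have [a1|a1] := leP 1 a.
    by apply: le_trans (leIl _ _) _; exact: sec_L_bound_le.
  by apply: le_trans (leIr _ _) _; apply: sec_L_bound_le => //; lra.
- apply: mean_U_le => a b ab; have [a1|a1] := leP a (-1).
    by apply: le_trans (leIl _ _) _; exact: sec_U_bound_le.
  by apply: le_trans (leIr _ _) _; apply: sec_U_bound_le => //; lra.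
Qed.

End Mean.

Section IntervalMaps.
Context (X : locale).
Implicit Types x y z w : locmap X interval.

Definition section_of x (g : rat + rat) : opens X :=
  preim x (@ideal1 interval_theory g).

Lemma section_ofP x : is_section (section_of x).
Proof. exact/model_section/locmap_model. Qed.

Definition mean x y : locmap X interval :=
  classify (section_model (mean_section (section_ofP x) (section_ofP y))).

Lemma section_of_mean x y g :
  section_of (mean x y) g = mean_fun (section_of x) (section_of y) g.
Proof. exact: classifyE. Qed.

Lemma section_of_inj x y : section_of x =1 section_of y -> x = y.
Proof. by move=> xy; apply: (@models_ext interval_theory). Qed.

Local Open Scope ring_scope.

Lemma mean_idem x : mean x x = x.
Proof.
apply: section_of_inj => g; rewrite section_of_mean; apply: le_anti.
have xP := section_ofP x.
apply/andP; split; case: g => q.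
- apply: mean_L_le => a b abq; have [qa|qa] := leP q a.
    by apply: le_trans (leIl _ _) _; exact: sec_L_le.
  by apply: le_trans (leIr _ _) _; apply: sec_L_le => //; lra.
- apply: mean_U_le => a b abq; have [qa|qa] := leP a q.
    by apply: le_trans (leIl _ _) _; exact: sec_U_le.
  by apply: le_trans (leIr _ _) _; apply: sec_U_le => //; lra.
- by rewrite -[leLHS]meetxx; apply: le_mean_L; lra.
- by rewrite -[leLHS]meetxx; apply: le_mean_U; lra.
Qed.

Lemma mean_comm x y : mean x y = mean y x.
Proof.
apply: section_of_inj => g; rewrite !section_of_mean.
wlog suff H : x y /
    (mean_fun (section_of x) (section_of y) g <=
     mean_fun (section_of y) (section_of x) g)%O.
  by apply: le_anti; rewrite !H.
case: g => q.
- by apply: mean_L_le => a b abq; rewrite meetC; apply: le_mean_L; lra.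
- by apply: mean_U_le => a b abq; rewrite meetC; apply: le_mean_U; lra.
Qed.

Lemma mean_medial x y z w :
  mean (mean x y) (mean z w) = mean (mean x z) (mean y w).
Proof.
apply: section_of_inj => g.
wlog suff H : x y z w / (section_of (mean (mean x y) (mean z w)) g <=
     section_of (mean (mean x z) (mean y w)) g)%O.
  by apply: le_anti; rewrite !H.
rewrite !section_of_mean; case: g => q.
- apply: mean_L_le => a b abq; rewrite !section_of_mean.
  apply: Sup_meet_le => _ [[c c'] /= ca <-].
  apply: meet_Sup_le => _ [[e e'] /= eb <-]; rewrite meetACA.
  apply: (@le_trans _ _ (Order.meet
      (section_of (mean x z) (inl ((c + e) / 2)))
      (section_of (mean y w) (inl ((c' + e') / 2))))).
    by rewrite !section_of_mean; apply: leI2; exact: le_mean_L.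
  by apply: le_mean_L; lra.
- apply: mean_U_le => a b abq; rewrite !section_of_mean.
  apply: Sup_meet_le => _ [[c c'] /= ca <-].
  apply: meet_Sup_le => _ [[e e'] /= eb <-]; rewrite meetACA.
  apply: (@le_trans _ _ (Order.meet
      (section_of (mean x z) (inr ((c + e) / 2)))
      (section_of (mean y w) (inr ((c' + e') / 2))))).
    by rewrite !section_of_mean; apply: leI2; exact: le_mean_U.
  by apply: le_mean_U; lra.
Qed.

End IntervalMaps.

Lemma mean_comp (X Y : locale) (x y : locmap Y interval) (f : locmap X Y) :
  locmap_comp (mean x y) f = mean (locmap_comp x f) (locmap_comp y f).
Proof.
apply: section_of_inj => g; rewrite section_of_mean.
rewrite -[LHS]/(preim f (section_of (mean x y) g)) section_of_mean.
by case: g => q; rewrite /= preimS image_comp; congr Sup;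
  apply: eq_imagel => ab _ /=; rewrite preimI.
Qed.

Definition interval_mid : locmap (locprod interval interval) interval :=
  mean (locfst interval interval) (locsnd interval interval).

Lemma interval_mid_pair (X : locale) (x y : locmap X interval) :
  locmap_comp interval_mid (locpair x y) = mean x y.
Proof. by rewrite mean_comp locfst_pair locsnd_pair. Qed.

Section IntervalAlgebra.
Local Open Scope cat_scope.
Let I : Loc := interval.
Let m : cprod I I ~> I := interval_mid.

Fact interval_mid_idem : m ∘ ⟨idm I, idm I⟩ = idm I.
Proof. by rewrite [LHS]interval_mid_pair [LHS]mean_idem. Qed.

Fact interval_mid_comm : m ∘ ⟨pi2, pi1⟩ = m.
Proof. by rewrite [LHS]interval_mid_pair [LHS]mean_comm. Qed.

Fact interval_mid_medial :
  let x : cprod (cprod I I) (cprod I I) ~> I := pi1 ∘ pi1 in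
  let y := pi2 ∘ pi1 in
  let z := pi1 ∘ pi2 in
  let w := pi2 ∘ pi2 in
  m ∘ ⟨m ∘ ⟨x, y⟩, m ∘ ⟨z, w⟩⟩ = m ∘ ⟨m ∘ ⟨x, z⟩, m ∘ ⟨y, w⟩⟩.
Proof.
move=> x y z w; rewrite [LHS]interval_mid_pair [RHS]interval_mid_pair.
by rewrite /= !interval_mid_pair; exact: mean_medial.
Qed.

Definition interval_algebra : midpointAlgebra Loc :=
  MidpointAlgebra interval_mid_idem interval_mid_comm interval_mid_medial.

End IntervalAlgebra.

(* Main.v *)
From mathcomp Require Import all_boot all_order all_algebra.
From mathcomp Require Import boolp classical_sets lra.
Require Import Defs.

(** The solutions of the equation are the fixed points of the operator
    [M |-> mean h (M \o t)] on the maps [X -> interval]. Any two such maps are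
    within uniform distance 2, and the operator halves uniform distances. Hence
    two fixed points are at distance 0, and the iterates of [h] form a Cauchy
    sequence, whose limit is a fixed point. *)

Set Implicit Arguments.
Unset Strict Implicit.
Unset Printing Implicit Defensive.

Import Order.TTheory GRing.Theory Num.Theory.

Local Open Scope classical_set_scope.
Local Open Scope ring_scope.

(* For [e >= 0], weakens the condition [g] on a real [x] to the condition that
   some real at distance at most [e] from [x] satisfies [g]. *)
Definition shift (e : rat) (g : rat + rat) : rat + rat :=
  match g with inl q => inl (q - e) | inr q => inr (q + e) end.

Lemma shift0 g : shift 0 g = g.
Proof. by case: g => q /=; rewrite ?subr0 ?addr0. Qed.

Lemma shiftD e e' g : shift e (shift e' g) = shift (e + e') g.
Proof. by case: g => q /=; congr (_ _); lra. Qed.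

Section Sections.
Context (d : Order.disp_t) (F : frameType d).
Implicit Types (x y z : rat + rat -> F) (e : rat).

(* The two halves of [g] make this the symmetric relation [|x - y| <= e]
   between sections, although it does not look symmetric. *)
Definition within e x y := forall g, (x g <= y (shift e g))%O.

Lemma sec_shift x e e' g : is_section x -> e <= e' ->
  (x (shift e g) <= x (shift e' g))%O.
Proof. by move=> xP ee'; case: g => q; [apply: sec_L_le|apply: sec_U_le] => //; lra. Qed.

(** A negative shift strengthens a condition, so this expresses roundedness of both cuts at once. *)
Lemma sec_rounded x g : is_section x ->
  (x g <= Sup [set x (shift (- e) g) | e in [set e : rat | 0 < e]])%O.
Proof.
move=> xP; case: g => q.
- apply: le_trans (sec_L_rounded xP q) _; apply: Sup_mono => _ [r /= qr <-].
  exists (x (inl r)) => //; exists (r - q) => /=; first by lra.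
  by congr (x (inl _)); lra.
- apply: le_trans (sec_U_rounded xP q) _; apply: Sup_mono => _ [r /= qr <-].
  exists (x (inr r)) => //; exists (q - r) => /=; first by lra.
  by congr (x (inr _)); lra.
Qed.

Lemma within_trans y x z e e' :
  within e x y -> within e' y z -> within (e + e') x z.
Proof.
move=> xy yz g; apply: le_trans (xy g) _.
by apply: le_trans (yz _) _; rewrite shiftD addrC.
Qed.

(** A lower bound [q] of [x] matters only if [q < 1]. Then [q - 2 < -1], and locatedness of [y]
    between these leaves only [q - 2] in its lower cut, as [-1] is never in the upper one. Upper
    bounds are dual. *)
Lemma within2 x y : is_section x -> is_section y -> within 2 x y.
Proof.
move=> xP yP [] q /=.
- have [q1|q1] := leP 1 q; first exact: sec_L_bound_le.
  apply: (@sec_located_le _ _ _ yP (q - 2) (-1)); rewrite ?leIr//; first by lra.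
  by apply: le_trans (leIr _ _) _; exact: sec_U_bound_le.
- have [q1|q1] := leP q (-1); first exact: sec_U_bound_le.
  apply: (@sec_located_le _ _ _ yP 1 (q + 2)); rewrite ?leIr//; first by lra.
  by apply: le_trans (leIr _ _) _; exact: sec_L_bound_le.
Qed.

(** Moving one summand by [e] moves the mean by [e / 2]: this is the contraction. *)
Lemma within_mean x y z e :
  within e y z -> within (e / 2) (mean_fun x y) (mean_fun x z).
Proof.
move=> yz [] q.
- apply: mean_L_le => a b abq.
  apply: le_trans (@le_mean_L _ _ _ _ a (b - e) _ _); last by lra.
  by apply: leI2 => //; exact: (yz (inl b)).
- apply: mean_U_le => a b abq.
  apply: le_trans (@le_mean_U _ _ _ _ a (b + e) _ _); last by lra.
  by apply: leI2 => //; exact: (yz (inr b)).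
Qed.

(** Roundedness first strengthens [g] by some [e > 0], which then pays for the passage from [x] to
    [y]. *)
Lemma within_small_le x y : is_section x -> is_section y ->
  (forall e, 0 < e -> within e x y) -> forall g, (x g <= y g)%O.
Proof.
move=> xP yP xy g; apply: le_trans (sec_rounded g xP) _.
apply: Sup_le => _ [e /= e0 <-]; apply: le_trans (xy e e0 _) _.
by rewrite shiftD subrr shift0.
Qed.

Section Limit.
Context (x : nat -> rat + rat -> F) (e : nat -> rat).
Hypotheses (xP : forall n, is_section (x n)) (e_ge0 : forall n, 0 <= e n).
Hypothesis e_small : forall a, 0 < a -> exists n, e n < a.
Hypothesis x_cauchy : forall m n, within (e (minn m n)) (x m) (x n).

(** The limit is to lie within [e n] of [x n], so it inherits every condition that [x n] satisfies
    with margin [e n]. *)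
Definition lim_fun (g : rat + rat) : F :=
  Sup [set x n (shift (- e n) g) | n in [set: nat]].

Lemma within_lim n : within (e n) (x n) lim_fun.
Proof.
by move=> g; apply: le_Sup; exists n => //; rewrite shiftD addNr shift0.
Qed.

(** Passing from [x m] to [x n] costs [e (minn m n) <= e m + e n], and the margin in [lim_fun]
    covers [e m]. *)
Lemma lim_within n : within (e n) lim_fun (x n).
Proof.
move=> g; apply: Sup_le => _ [m _ <-]; apply: le_trans (x_cauchy m n _) _.
rewrite shiftD; apply: sec_shift => //.
have := e_ge0 m; have := e_ge0 n; rewrite /minn; case: ifP => _; lra.
Qed.

Lemma lim_shift a b g : a <= b ->
  (lim_fun (shift a g) <= lim_fun (shift b g))%O.
Proof.
move=> ab; apply: Sup_mono => _ [n _ <-].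
exists (x n (shift (- e n) (shift b g))); first by exists n.
by rewrite !shiftD; apply: sec_shift => //; lra.
Qed.

Lemma lim_rounded g :
  (lim_fun g <= Sup [set lim_fun (shift (- a) g) | a in [set a : rat | 0 < a]])%O.
Proof.
apply: Sup_le => _ [n _ <-]; apply: le_trans (sec_rounded _ (xP n)) _.
apply: Sup_mono => _ [a /= a0 <-]; exists (lim_fun (shift (- a) g)); first by exists a.
by apply: le_Sup; exists n => //; rewrite !shiftD addrC.
Qed.

Lemma lim_section : is_section lim_fun.
Proof.
split.
- apply: le_trans (sec_L_inhabited (xP 0)) _; apply: Sup_le => _ [q _ <-].
  by apply: le_trans (within_lim 0 _) _; apply: le_Sup; exists (q - e 0).
- apply: le_trans (sec_U_inhabited (xP 0)) _; apply: Sup_le => _ [q _ <-].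
  by apply: le_trans (within_lim 0 _) _; apply: le_Sup; exists (q + e 0).
- move=> q r qr; rewrite -[inl r]shift0.
  have -> : inl q = shift (r - q) (inl r) by congr inl; lra.
  by apply: lim_shift; lra.
- move=> q r qr; rewrite -[inr q]shift0.
  have -> : inr r = shift (r - q) (inr q) by congr inr; lra.
  by apply: lim_shift; lra.
- move=> q; apply: le_trans (lim_rounded _) _.
  (* The witness [q - - a] has the form to which [shift (- a) (inl q)] computes. *)
  apply: Sup_le => _ [a /= a0 <-]; apply: le_Sup; exists (q - - a) => //=; lra.
- move=> q; apply: le_trans (lim_rounded _) _.
  apply: Sup_le => _ [a /= a0 <-]; apply: le_Sup; exists (q + - a) => //=; lra.
- move=> q; apply: Sup_meet_le => _ [m _ <-]; apply: meet_Sup_le => _ [n _ <-].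
  (* Moved to the single section [x n], the lower bound [q + e m - e (minn m n)] is at least the
     upper bound [q - e n]. *)
  apply: le_trans (leI2 (x_cauchy m n _) (lexx _)) _.
  rewrite !shiftD; apply: (sec_disjoint_le (xP n)).
  have := e_ge0 m; have := e_ge0 n; rewrite /minn; case: ifP => _; lra.
(* Passing from [x n] to the limit costs [e n] at each end of the gap, hence the half. *)
- move=> q r qr; have [n en] : exists n, e n < (r - q) / 2 by apply: e_small; lra.
  have qr' : q + e n < r - e n by lra.
  apply: le_trans (sec_located (xP n) qr') _; apply: Sup_le => _ [|] ->.
  + apply: le_trans (within_lim n _) _; apply: le_Sup; left.
    by congr (lim_fun (inl _)); lra.
  + apply: le_trans (within_lim n _) _; apply: le_Sup; right.
    by congr (lim_fun (inr _)); lra.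
- apply: Sup_le => _ [n _ <-]; apply: (sec_L_bound_le (xP n)).
  by have := e_ge0 n; lra.
- apply: Sup_le => _ [n _ <-]; apply: (sec_U_bound_le (xP n)).
  by have := e_ge0 n; lra.
Qed.

End Limit.

End Sections.

Section FixedPoint.
Context (X : locale) (h : locmap X interval) (t : locmap X X).
Implicit Types (M N : locmap X interval) (e : rat).

Definition mean_step M : locmap X interval := mean h (locmap_comp M t).

Definition maps_within e M N := within e (section_of M) (section_of N).

Lemma mean_step_within e M N :
  maps_within e M N -> maps_within (e / 2) (mean_step M) (mean_step N).
Proof.
move=> MN g; rewrite !section_of_mean; apply: within_mean => g' /=.
(* Composition with [t] preserves uniform distance, because preimages are monotone. *)
exact: preim_mono (MN g').
Qed.

Let eps (n : nat) : rat := 2 / 2 ^+ n.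

Let eps_ge0 n : 0 <= eps n.
Proof. by rewrite /eps divr_ge0// exprn_ge0. Qed.

Let epsS n : eps n.+1 = eps n / 2.
Proof. by rewrite /eps exprSr invfM mulrA. Qed.

Let eps_small e : 0 < e -> exists n, eps n < e.
Proof.
move=> e0; exists (Num.bound (2 / e)).
have e2 : 0 <= 2 / e by apply: divr_ge0; lra.
rewrite /eps ltr_pdivrMr ?exprn_gt0// mulrC -ltr_pdivrMr//.
apply: lt_trans (archi_boundP e2) _.
by rewrite -natrX ltr_nat ltn_expl.
Qed.

Lemma iter_mean_step_within n M N :
  maps_within (eps n) (iter n mean_step M) (iter n mean_step N).
Proof.
elim: n => [|n IH] /=.
  by rewrite /eps expr0 divr1; apply: within2; exact: section_ofP.
rewrite epsS; exact: mean_step_within.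
Qed.

(** Each direction of [maps_within] gives one of the two inequalities between opens. *)
Lemma maps_within_eq M N :
  (forall n, exists2 e, e <= eps n & maps_within e M N /\ maps_within e N M) ->
  M = N.
Proof.
move=> MN; apply: section_of_inj => g; apply: le_anti; apply/andP.
have MP := section_ofP M; have NP := section_ofP N.
split; apply: within_small_le => // e /eps_small[n en] g';
  have [e' e'n [MN' NM']] := MN n.
- by apply: le_trans (MN' g') _; apply: sec_shift => //; lra.
- by apply: le_trans (NM' g') _; apply: sec_shift => //; lra.
Qed.

Lemma mean_step_fixed_unique M N : mean_step M = M -> mean_step N = N -> M = N.
Proof.
move=> MM NN; apply: maps_within_eq => n; exists (eps n) => //.
have fixI P : mean_step P = P -> iter n mean_step P = P.
  by move=> PP; elim: n => //= k ->.
have := iter_mean_step_within n M N; have := iter_mean_step_within n N M.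
by rewrite !fixI.
Qed.

Let approx (n : nat) := section_of (iter n mean_step h).

Let approx_section n : is_section (approx n).
Proof. exact: section_ofP. Qed.

Let approx_cauchy m n : within (eps (minn m n)) (approx m) (approx n).
Proof.
(* Both iterates arise by the same [minn m n] steps from two starting maps, whose distance is at
   most 2 anyway. *)
have split_iter k : (minn m n <= k)%N -> iter k mean_step h =
    iter (minn m n) mean_step (iter (k - minn m n) mean_step h).
  by move=> lek; rewrite -iterD subnKC.
rewrite /approx (split_iter m) ?geq_minl// (split_iter n) ?geq_minr//.
exact: iter_mean_step_within.
Qed.

Let approx_lim_section : is_section (lim_fun approx eps).
Proof. exact: lim_section. Qed.

Definition mean_lim : locmap X interval :=
  classify (section_model approx_lim_section).

Lemma section_of_mean_lim g : section_of mean_lim g = lim_fun approx eps g.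
Proof. exact: classifyE. Qed.

Lemma mean_lim_fixed : mean_step mean_lim = mean_lim.
Proof.
have to_lim n : maps_within (eps n) (iter n mean_step h) mean_lim.
  by move=> g; rewrite section_of_mean_lim; exact: within_lim.
have of_lim n : maps_within (eps n) mean_lim (iter n mean_step h).
  by move=> g; rewrite section_of_mean_lim; exact: lim_within.
(* The triangle inequality goes through iterate [n.+1]: one [eps n.+1] is the contracted distance
   [eps n / 2], the other its distance to the limit. *)
apply: maps_within_eq => n; exists (eps n.+1 + eps n.+1).
  by rewrite epsS; lra.
split; apply: (@within_trans _ _ (approx n.+1)).
- by rewrite epsS; apply: mean_step_within.
- exact: to_lim.
- exact: of_lim.
- by rewrite epsS; apply: mean_step_within.
Qed.

End FixedPoint.

Theorem theorem4p4 : iterative interval_algebra.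
Proof.
move=> X h t.
have stepE (M : X ~> interval_algebra) :
    (mid interval_algebra ∘ (idm _ ⊗ M) ∘ ⟨h, t⟩)%cat = mean_step h t M.
  rewrite /prodmap [X in (X ∘ _)%cat]interval_mid_pair [LHS]mean_comp.
  rewrite /= -!locmap_compA locfst_pair locsnd_pair.
  by rewrite locmap_comp1m.
exists (mean_lim h t); split; first by rewrite stepE mean_lim_fixed.
move=> N; rewrite stepE => NN; apply: mean_step_fixed_unique (esym NN).
exact: mean_lim_fixed.
Qed.
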